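(* Let $(M,\tau)$ be a tracial von Neumann algebra with unital $*$-subalgebra $B\subset M$ and finite subset $X=X^*\subset M$ so that $B\langle X\rangle''=M$. Let $d\in\mathbb{N}$ and suppose $(P^{(i)})_{i\in I}\subset B\langle T_X\rangle^d$ is a net such that $(P^{(i)}(X))_{i\in I}$ converges weakly to zero (in $L^2(M,\tau)^{\oplus d}$) while $((\mathscr{J}_{X:B}P^{(i)})(X))_{i\in I}$ converges coordinate-wise in the weak operator topology to some $H\in M_{d\times|X|}(M\bar\otimes M^\circ)$. Then \[ \sigma(B\subset B\langle X\rangle,\tau)\leq\dim(\ker H)_{M\bar\otimes M^\circ}, \] where $\ker(H)_{M\bar\otimes M^\circ}\leq L^2(M\bar\otimes M^\circ,\tau\otimes\tau^\circ)^X_{M\bar\otimes M^\circ}$ under the diagonal right action. In particular, if $P(X)=0$ for some $P\in B\langle T_X\rangle^d$, then \[ \sigma(B\subset B\langle X\rangle,\tau)\leq\dim\big(\ker(\mathscr{J}_{X:B}P)(X)\big)_{M\bar\otimes M^\circ}. \]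
   Context: A tracial von Neumann algebra $(M,\tau)$ is a finite von Neumann algebra $M$ with a faithful normal tracial state $\tau$. $M^\circ$ is the opposite algebra with trace $\tau^\circ$, and $M\bar\otimes M^\circ$ carries the trace $\tau\otimes\tau^\circ$. $B\langle X\rangle$ is the unital $*$-algebra generated by $B\cup X$. Let $T_X=\{t_x:x\in X\}$ be formal variables with $t_x^*=t_{x^*}$; $B\langle T_X\rangle$ is the $*$-algebra formally spanned by the words $b_0t_{x_1}b_1\cdots t_{x_k}b_k$ ($b_j\in B$, $x_j\in X$), i.e. noncommutative polynomials with coefficients in $B$; $p(X)\in B\langle X\rangle$ is the evaluation at $t_x=x$. The free difference quotients $\partial_{x:B}\colon B\langle T_X\rangle\to B\langle T_X\rangle\otimes B\langle T_X\rangle^\circ$ are the derivations with $\partial_{x:B}(pq)=p\,\partial_{x:B}(q)+\partial_{x:B}(p)\,q$, vanishing on $B$, and $\partial_{x:B}(t_y)=\delta_{x=y}1\otimes1$. For $P=(p_1,\ldots,p_d)$, $(\mathscr{J}_{X:B}P)(X)=\big((\partial_{x:B}p_j)(X)\big)_{j,x}\in M_{d\times|X|}(B\langle X\rangle\otimes B\langle X\rangle^\circ)$. A matrix $H\in M_{d\times|X|}(M\bar\otimes M^\circ)$ acts by left multiplication as an operator $L^2(M\bar\otimes M^\circ,\tau\otimes\tau^\circ)^X\to L^2(M\bar\otimes M^\circ,\tau\otimes\tau^\circ)^d$, whose kernel is a right Hilbert $M\bar\otimes M^\circ$-module; $\dim(\cdot)_{M\bar\otimes M^\circ}$ is its von Neumann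 dimension with respect to $\tau\otimes\tau^\circ$. For $A=B\langle X\rangle$, $L^2(A\otimes A^\circ,\tau\otimes\tau^\circ)$ is the closure of $A\otimes A^\circ$ in $L^2(M\bar\otimes M^\circ,\tau\otimes\tau^\circ)$; it is an $A$-$A$ bimodule via $x\cdot\xi\cdot y=(x\otimes y^\circ)\xi$ and has the commuting right action of the von Neumann algebra $(A\otimes A^\circ)''$ generated by $A\otimes A^\circ$. $\mathrm{Der}_{1\otimes1}(B\subset A,\tau)$ is the space of derivations $\delta\colon A\to L^2(A\otimes A^\circ,\tau\otimes\tau^\circ)$ (linear, $\delta(xy)=x\cdot\delta(y)+\delta(x)\cdot y$) vanishing on $B$ such that $1\otimes1\in\mathrm{dom}(\delta^* )$, where $\delta$ is viewed as a densely defined operator $L^2(A,\tau)\to L^2(A\otimes A^\circ,\tau\otimes\tau^\circ)$. The map $\phi_X(\delta)=(\delta(x))_{x\in X}$ is injective and right $(A\otimes A^\circ)''$-linear with closed range from the space of all derivations vanishing on $B$ into $L^2(A\otimes A^\circ,\tau\otimes\tau^\circ)^X$, giving the norm $\|\delta\|_X=(\sum_x\|\delta(x)\|^2)^{1/2}$ in which closures are taken. The free Stein dimension $\sigma(B\subset A,\tau)$ is the von Neumann dimension (with respect to $\tau\otimes\tau^\circ$) of the right Hilbert $(A\otimes A^\circ)''$-module $\phi_X\big(\overline{\mathrm{Der}_{1\otimes1}(B\subset A,\tau)}\big)$; it does not depend on the finite generating set $X=X^*$ of $A$ over $B$. *)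

(* Defs.v *)
From HB Require Import structures.
From mathcomp Require Import all_boot all_order all_algebra complex.
From mathcomp Require Import all_classical all_reals all_analysis.
Set Implicit Arguments.
Unset Strict Implicit.
Unset Printing Implicit Defensive.
Import Order.TTheory GRing.Theory Num.Theory Num.Def.
Import numFieldNormedType.Exports.
Local Open Scope classical_set_scope.
Local Open Scope ring_scope.

(* Complex Hilbert spaces; the inner product is linear on the left. *)
Record hilbertType (R : realType) := Hilbert {
  hcarrier :> completeNormedModType R[i];
  hdot : {dot hcarrier for (@conjC R[i])};
  hdot_norm : forall u : hcarrier, hdot u u = `|u| ^+ 2 }.

Definition inner (R : realType) (H : hilbertType R) (u v : H) :
    (R[i] : numFieldType) := hdot H u v.

Section Operators.
Context {R : realType} {H : hilbertType R}.
Implicit Types (S T : H -> H) (M A B : set (H -> H)).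

Definition bounded_op T := linear T /\ continuous T.

Definition is_adjoint T S := forall u v, inner (T u) v = inner u (S v).

Definition commutant M : set (H -> H) :=
  [set T | bounded_op T /\ forall S, M S -> T \o S = S \o T].

Definition star_subalgebra A :=
  [/\ A `<=` bounded_op,
      A idfun,
      (forall (c : R[i]) S T, A S -> A T -> A (c *: S + T)),
      (forall S T, A S -> A T -> A (S \o T)) &
      (forall T, A T -> exists2 T', A T' & is_adjoint T T')].

Definition is_vna M := star_subalgebra M /\ commutant (commutant M) = M.

(* S <= T; on the complex numbers, z <= w says that w - z is a nonnegative
   real, so that op_le 0 T is positivity of T. *)
Definition op_le S T := forall u, inner (S u) u <= inner (T u) u.

Definition op_is_sup M (D : set (H -> H)) S :=
  [/\ M S, (forall T, D T -> op_le T S) &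
      (forall S', M S' -> (forall T, D T -> op_le T S') -> op_le S S')].

(* tau is only meaningful on M.  Normality: tau preserves the suprema in M of
   upward directed sets of positive elements. *)
Definition faithful_normal_tracial_state M (tau : (H -> H) -> R[i]) :=
  [/\ (forall (c : R[i]) S T, M S -> M T ->
         tau (c *: S + T) = c * tau S + tau T) /\ tau idfun = 1,
      (forall T, M T -> op_le 0 T -> 0 <= tau T),
      (forall T, M T -> op_le 0 T -> tau T = 0 -> T = 0),
      (forall S T, M S -> M T -> tau (S \o T) = tau (T \o S)) &
      (forall D S,
         D !=set0 -> D `<=` M -> (forall T, D T -> op_le 0 T) ->
         (forall T1 T2, D T1 -> D T2 ->
            exists T, [/\ D T, op_le T1 T & op_le T2 T]) ->
         op_is_sup M D S ->
         forall c : R[i], (forall T, D T -> tau T <= c) -> tau S <= c)].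

(* The unital *-algebra B<X> generated by B and the x_i. *)
Definition gen_alg B n (X : 'I_n -> (H -> H)) : set (H -> H) :=
  [set T | forall A, star_subalgebra A -> B `<=` A -> (forall i, A (X i)) ->
     A T].

End Operators.

(* (L, Lam) is L^2(M, tau), Lam being the canonical map from M. *)
Definition is_L2 (R : realType) (H L : hilbertType R) (M : set (H -> H))
    (tau : (H -> H) -> R[i]) (Lam : (H -> H) -> L) :=
  [/\ (forall (c : R[i]) a b, M a -> M b ->
         Lam (c *: a + b) = c *: Lam a + Lam b),
      (forall a b b', M a -> M b -> M b' -> is_adjoint b b' ->
         inner (Lam a) (Lam b) = tau (b' \o a)) &
      dense (Lam @` M)].

(* The vectors of the algebraic tensor product A (x) A^o, Th a b being the
   vector of a (x) b^o. *)
Definition tens_span (R : realType) (H K : hilbertType R) (A : set (H -> H))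
    (Th : (H -> H) -> (H -> H) -> K) : set K :=
  [set v | exists (m : nat) (a b : 'I_m -> (H -> H)),
     (forall i, A (a i) /\ A (b i)) /\ v = \sum_i Th (a i) (b i)].

(* (K, Th) is L^2(M (x) M^o, tau (x) tau^o): the product of M^o is reversed,
   so that
     <a (x) b^o, c (x) d^o> = tau (c^* a) tau^o ((d^o)^* b^o)
                            = tau (c^* a) tau (b d^* ).
   act x y is the operator of left multiplication by x (x) y^o, hence
   act x y (a (x) b^o) = xa (x) y^o b^o = xa (x) (by)^o. *)
Definition is_L2_tensor_op (R : realType) (H K : hilbertType R)
    (M : set (H -> H)) (tau : (H -> H) -> R[i])
    (Th : (H -> H) -> (H -> H) -> K) (act : (H -> H) -> (H -> H) -> K -> K) :=
  [/\ (forall (c : R[i]) a a' b, M a -> M a' -> M b ->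
         Th (c *: a + a') b = c *: Th a b + Th a' b) /\
      (forall (c : R[i]) a b b', M a -> M b -> M b' ->
         Th a (c *: b + b') = c *: Th a b + Th a b'),
      (forall a b c c' d d', M a -> M b -> M c -> M c' -> M d -> M d' ->
         is_adjoint c c' -> is_adjoint d d' ->
         inner (Th a b) (Th c d) = tau (c' \o a) * tau (b \o d')),
      dense (tens_span M Th),
      (forall x y, M x -> M y -> bounded_op (act x y)) &
      (forall x y a b, M x -> M y -> M a -> M b ->
         act x y (Th a b) = Th (x \o a) (b \o y))].

(* M (x) M^o completed as a von Neumann algebra on L^2(M (x) M^o). *)
Definition vn_tensor_op (R : realType) (H K : hilbertType R)
    (M : set (H -> H)) (act : (H -> H) -> (H -> H) -> K -> K) : set (K -> K) :=
  commutant (commutant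
    [set T | exists x y, [/\ M x, M y & T = act x y]]).

(* Elements of B<T_X>, presented by expressions: Coef b for b in B, Var i for
   t_{x_i}.  Distinct expressions may denote the same element of B<T_X>;
   evaluation at X and evaluated difference quotients only depend on the
   element.  Coefficients range over a type C, cut down to B by nc_over. *)
Inductive ncpoly (C : Type) (n : nat) : Type :=
  | Coef of C
  | Var of 'I_n
  | Add of ncpoly C n & ncpoly C n
  | Mul of ncpoly C n & ncpoly C n.
Arguments Coef {C n}.
Arguments Var {C n}.

Fixpoint nc_over (C : Type) (n : nat) (B : set C) (p : ncpoly C n) : Prop :=
  match p with
  | Coef b => B b
  | Var _ => True
  | Add p q | Mul p q => nc_over B p /\ nc_over B q
  end.

(* The free difference quotient with respect to t_{x_i}, where one : C is the
   unit of B.  A list of pairs (p, q) stands for the sum of the p (x) q^o in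
   B<T_X> (x) B<T_X>^o, and p . (a (x) b^o) . q = pa (x) (bq)^o. *)
Fixpoint nc_diff (C : Type) (n : nat) (one : C) (i : 'I_n) (p : ncpoly C n) :
    seq (ncpoly C n * ncpoly C n) :=
  match p with
  | Coef _ => [::]
  | Var j => if j == i then [:: (Coef one, Coef one)] else [::]
  | Add p q => nc_diff one i p ++ nc_diff one i q
  | Mul p q => [seq (Mul p t.1, t.2) | t <- nc_diff one i q]
            ++ [seq (t.1, Mul t.2 q) | t <- nc_diff one i p]
  end.

Fixpoint nc_eval (R : realType) (H : hilbertType R) (n : nat)
    (X : 'I_n -> (H -> H)) (p : ncpoly (H -> H) n) : H -> H :=
  match p with
  | Coef b => b
  | Var i => X i
  | Add p q => nc_eval X p + nc_eval X q
  | Mul p q => nc_eval X p \o nc_eval X q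
  end.

Definition nc_jacobian (R : realType) (H K : hilbertType R)
    (act : (H -> H) -> (H -> H) -> K -> K) (n d : nat)
    (X : 'I_n -> (H -> H)) (P : 'I_d -> ncpoly (H -> H) n) : 'M[K -> K]_(d, n) :=
  \matrix_(j, i) \sum_(t <- nc_diff idfun i (P j))
     act (nc_eval X t.1) (nc_eval X t.2).

Definition mx_ker (R : realType) (K : hilbertType R) (d n : nat)
    (T : 'M[K -> K]_(d, n)) : set ('I_n -> K) :=
  [set v | forall j, \sum_i T j i (v i) = 0].

Section Dimension.
Context {R : realType} {K : hilbertType R} {n : nat}.

(* Orthogonal projection onto a closed subspace V of the direct sum K^n. *)
Definition orth_proj (V : set ('I_n -> K)) (v : 'I_n -> K) : 'I_n -> K :=
  xget 0 [set w | V w /\ forall u, V u -> \sum_i inner (v i - w i) (u i) = 0].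

(* Entry (i, j) of an operator of K^n. *)
Definition op_entry (T : ('I_n -> K) -> ('I_n -> K)) (i j : 'I_n) (u : K) : K :=
  T (fun k => if k == j then u else 0) i.

(* The von Neumann dimension of a closed right submodule V of L^2(N)^n, where
   Omega is the vector of 1 and N acts by left multiplication, with trace
   T |-> <T Omega, Omega>: the projection p onto V is in M_n(N), and
   dim V = (Tr (x) trace)(p). *)
Definition vn_dim (Omega : K) (V : set ('I_n -> K)) : R :=
  complex.Re (\sum_i inner (op_entry (orth_proj V) i i Omega) Omega).

End Dimension.

Section FreeStein.
Context {R : realType} {H L K : hilbertType R}.
Variables (Lam : (H -> H) -> L) (Th : (H -> H) -> (H -> H) -> K).
Variable act : (H -> H) -> (H -> H) -> K -> K.
Variables (B A : set (H -> H)).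

(* Derivations A -> L^2(A (x) A^o) vanishing on B; delta is only meaningful
   on A. *)
Definition derivation (delta : (H -> H) -> K) :=
  [/\ (forall a, A a -> closure (tens_span A Th) (delta a)),
      (forall (c : R[i]) a b, A a -> A b ->
         delta (c *: a + b) = c *: delta a + delta b),
      (forall a b, A a -> A b ->
         delta (a \o b) = act a idfun (delta b) + act idfun b (delta a)) &
      (forall b, B b -> delta b = 0)].

(* eta is in the domain of the adjoint of delta, viewed as a densely defined
   operator from L^2(A) to L^2(A (x) A^o). *)
Definition in_dom_adjoint (delta : (H -> H) -> K) (eta : K) :=
  exists2 zeta : L, closure (Lam @` A) zeta &
    forall a, A a -> inner (delta a) eta = inner (Lam a) zeta.

Definition Der11 (delta : (H -> H) -> K) :=
  derivation delta /\ in_dom_adjoint delta (Th idfun idfun).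

(* The image under phi_X of the closure of Der_{1 (x) 1} in the space of all
   derivations vanishing on B, for the norm || . ||_X. *)
Definition phi_closure_Der11 (n : nat) (X : 'I_n -> (H -> H)) :
    set ('I_n -> K) :=
  [set v | exists delta, [/\ derivation delta,
     (forall e : R[i], 0 < e -> exists delta', Der11 delta' /\
        sqrtC (\sum_i `|delta (X i) - delta' (X i)| ^+ 2) < e) &
     v = (fun i => delta (X i))]].

End FreeStein.

(* sigma(B in B<X>, tau), computed with the generating set X. *)
Definition free_stein_dim (R : realType) (H L K : hilbertType R)
    (Lam : (H -> H) -> L) (Th : (H -> H) -> (H -> H) -> K)
    (act : (H -> H) -> (H -> H) -> K -> K) (B : set (H -> H)) (n : nat)
    (X : 'I_n -> (H -> H)) : R :=
  vn_dim (Th idfun idfun) (phi_closure_Der11 Lam Th act B (gen_alg B X) X).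

Definition directed (I : Type) (le : I -> I -> Prop) :=
  [/\ (exists i : I, True), (forall i, le i i),
      (forall i j k, le i j -> le j k -> le i k) &
      (forall i j, exists k, le i k /\ le j k)].

Definition net_filter (I : Type) (le : I -> I -> Prop) : set_system I :=
  [set E | exists i0, forall i, le i0 i -> E i].

Definition weak_cvg (R : realType) (H : hilbertType R) (I : Type)
    (le : I -> I -> Prop) (v : I -> H) (w : H) :=
  forall u : H, (fun i => inner (v i) u) @ net_filter le --> inner w u.

Definition wot_cvg (R : realType) (H : hilbertType R) (I : Type)
    (le : I -> I -> Prop) (T : I -> (H -> H)) (S : H -> H) :=
  forall u v : H,
    (fun i => inner (T i u) v) @ net_filter le --> inner (S u) v.

(* Main.v *)
From HB Require Import structures.
Require Import Defs.
From mathcomp Require Import all_boot all_order all_algebra.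
From mathcomp Require Import complex.
From mathcomp Require Import ring.
From mathcomp Require Import all_classical all_reals all_analysis.
Set Implicit Arguments.
Unset Strict Implicit.
Unset Printing Implicit Defensive.
Import Order.TTheory GRing.Theory Num.Theory Num.Def.
Import numFieldNormedType.Exports.
Local Open Scope classical_set_scope.
Local Open Scope ring_scope.

(* Von Neumann dimension is monotone under inclusion, so it suffices that every
   delta in Der_{1 (x) 1}, hence also every limit of such derivations, satisfies
   w := sum_k H_jk delta(x_k) = 0.  By the chain rule,
   delta(p(X)) = sum_k (d_k p)(X) delta(x_k), so delta(P^(i)_j(X)) converges
   weakly to w.  Since 1 (x) 1 is in the domain of delta^*, so is every a (x) b
   with a, b in A = B<X>; as P^(i)_j(X) tends weakly to 0, w is orthogonal to
   A (x) A^o.  Each delta(P^(i)_j(X)) lies in the closure of A (x) A^o, hence is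
   orthogonal to w, and passing to the limit <w, w> = 0. *)

(** * Inner products on [K] and on finite sums of copies of [K] *)

Section Hilbert.
Context {R : realType} {K : hilbertType R}.
Implicit Types (u v w x y z : K) (c : R[i]).

Lemma innerDl u v w : inner (u + v) w = inner u w + inner v w.
Proof. exact: linearDl. Qed.

Lemma innerBl u v w : inner (u - v) w = inner u w - inner v w.
Proof. exact: linearBl. Qed.

Lemma innerZl c u w : inner (c *: u) w = c * inner u w.
Proof. exact: linearZl_LR. Qed.

Lemma inner0l w : inner 0 w = 0 :> R[i].
Proof. exact: linear0l. Qed.

Lemma innerC u v : inner u v = (inner v u)^*.
Proof. by have := hermC (@hdot R K) u v; rewrite expr0 mul1r. Qed.

Lemma innerZr c u v : inner u (c *: v) = c^* * inner u v.
Proof. by rewrite innerC innerZl rmorphM/= -innerC. Qed.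

Lemma inner_norm u : inner u u = `|u| ^+ 2 :> R[i].
Proof. exact: hdot_norm. Qed.

Lemma inner_suml I (r : seq I) (E : I -> K) w :
  inner (\sum_(i <- r) E i) w = \sum_(i <- r) inner (E i) w :> R[i].
Proof.
apply: (big_morph (fun u => inner u w : R[i])) => [u v|].
- exact: innerDl.
- exact: inner0l.
Qed.

Lemma inner_eq0 u : (forall v, inner u v = 0 :> R[i]) -> u = 0.
Proof.
by move=> /(_ u)/eqP; rewrite inner_norm expf_eq0/= normr_eq0 => /eqP.
Qed.

Section Sums.
Variable n : nat.
Implicit Types (f g h : 'I_n -> K).

(** The inner product of the Hilbert sum of [n] copies of [K], written out on tuples so that no
    [hilbertType] has to be built on the sum. *)
Definition dotn f g : R[i] := \sum_i inner (f i) (g i).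

Lemma dotnC f g : dotn f g = (dotn g f)^*.
Proof. by rewrite /dotn rmorph_sum/=; apply: eq_bigr => i _; rewrite -innerC. Qed.

Lemma dotnBl f g h : dotn (fun i => f i - g i) h = dotn f h - dotn g h.
Proof. by rewrite /dotn -sumrB; apply: eq_bigr => i _; rewrite innerBl. Qed.

Lemma dotnBr f g h : dotn f (fun i => g i - h i) = dotn f g - dotn f h.
Proof. by rewrite dotnC dotnBl rmorphB/= -!dotnC. Qed.

Lemma dotnZl c f g : dotn (fun i => c *: f i) g = c * dotn f g.
Proof. by rewrite /dotn mulr_sumr; apply: eq_bigr => i _; rewrite innerZl. Qed.

Lemma dotnZr c f g : dotn f (fun i => c *: g i) = c^* * dotn f g.
Proof. by rewrite dotnC dotnZl rmorphM/= -dotnC. Qed.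

Lemma dotn_norm f : dotn f f = \sum_i `|f i| ^+ 2.
Proof. by apply: eq_bigr => i _; rewrite inner_norm. Qed.

Lemma dotn_ge0 f : 0 <= dotn f f.
Proof. by rewrite dotn_norm sumr_ge0// => i _; rewrite exprn_ge0. Qed.

Lemma norm_le_dotn f i : `|f i| ^+ 2 <= dotn f f.
Proof.
rewrite dotn_norm (bigD1 i)//= lerDl sumr_ge0// => j _; exact: exprn_ge0.
Qed.

Lemma dotn0 f g : dotn g g = 0 -> dotn f g = 0.
Proof.
move=> g0; rewrite /dotn big1// => i _.
have : `|g i| ^+ 2 == 0 by rewrite eq_le exprn_ge0// -g0 norm_le_dotn.
rewrite sqrf_eq0 normr_eq0 => /eqP ->.
by rewrite innerC inner0l rmorph0.
Qed.

(* The right-hand side of the hypothesis is smallest at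
   [c = dotn f g / dotn g g], where it is
   [dotn f f - `|dotn f g| ^+ 2 / dotn g g + e]. *)
Lemma near_minimizer_dot (e : R[i]) f g :
  (forall c, dotn f f <=
     dotn (fun i => f i - c *: g i) (fun i => f i - c *: g i) + e) ->
  `|dotn f g| ^+ 2 <= e * dotn g g.
Proof.
have [/[dup] g0 /dotn0 -> _|g0] := eqVneq (dotn g g) 0.
  by rewrite g0 normr0 expr0n mulr0.
have gr : (dotn g g)^* = dotn g g by rewrite -dotnC.
have gp : 0 < dotn g g by rewrite lt_def g0 dotn_ge0.
move=> /(_ (dotn f g / dotn g g)).
rewrite dotnBl !dotnBr !dotnZl !dotnZr (dotnC g f) rmorphM/= fmorphV/= gr.
set a := dotn f f; set b := dotn g g; set q := dotn f g.
have -> : a - q^* / b * q - (q / b * q^* - q / b * (q^* / b * b)) =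
    a - `|q| ^+ 2 / b.
  rewrite normCK divfK//.
  have -> : q^* / b * q = q / b * q^* by rewrite mulrAC (mulrC q^*) mulrAC.
  by rewrite subrr subr0 mulrAC.
rewrite addrAC -addrA lerDl subr_ge0 ler_pdivrMr//.
Qed.

(** With slack [e = dotn f f] the hypothesis of [near_minimizer_dot] only says that a squared norm
    is nonnegative. *)
Lemma dotn_CauchySchwarz f g : `|dotn f g| ^+ 2 <= dotn f f * dotn g g.
Proof. by apply: near_minimizer_dot => c; rewrite lerDr dotn_ge0. Qed.

End Sums.

Lemma inner_CauchySchwarz u v : `|inner u v : R[i]| <= `|u| * `|v|.
Proof.
have := @dotn_CauchySchwarz 1 (fun=> u) (fun=> v).
rewrite /dotn !big_ord1 !inner_norm -exprMn ler_pXn2r// nnegrE ?mulr_ge0//.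
Qed.
Lemma cvg_inner {T : Type} {F : set_system T} {FF : Filter F}
    (u : T -> K) (w z : K) :
  u @ F --> w -> (fun t => inner (u t) z) @ F --> inner w z.
Proof.
move=> uw; apply/cvgrPdist_le => e e0.
(* Adding 1 keeps the divisor positive when [z = 0]. *)
have z0 : 0 < `|z| + 1 by rewrite ltr_wpDl.
move/cvgrPdist_le: uw => /(_ _ (divr_gt0 e0 z0)).
apply: filterS => m um; rewrite -innerBl.
apply: (le_trans (inner_CauchySchwarz _ _)).
apply: (@le_trans _ _ (`|w - u m| * (`|z| + 1))).
  by rewrite ler_wpM2l// lerDl.
by rewrite -ler_pdivlMr.
Qed.

End Hilbert.

Lemma cvg_sum {k : numFieldType} {W : normedModType k} {T I : Type}
    (F : set_system T) {FF : Filter F} (r : seq I) (f : I -> T -> W) (l : I -> W) :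
  (forall i, f i @ F --> l i) ->
  (fun t => \sum_(i <- r) f i t) @ F --> \sum_(i <- r) l i.
Proof. by move=> fl; apply: cvg_big => // x; exact: add_continuous. Qed.

(** * Orthogonal projection by near minimizers *)

Section Projection.
Context {R : realType} {K : hilbertType R} {n : nat}.
Variable V : set ('I_n -> K).
Hypothesis V0 : V (fun=> 0).
Hypothesis VP : forall (c : R[i]) f g, V f -> V g -> V (fun i => c *: f i + g i).

(** A subspace that may fail to be closed need not contain a nearest point; [e] is the slack allowed
    in the squared distance. *)
Definition near_minimizer (e : R[i]) (v f : 'I_n -> K) :=
  V f /\ forall g, V g ->
    dotn (fun i => v i - f i) (fun i => v i - f i) <=
    dotn (fun i => v i - g i) (fun i => v i - g i) + e.

(** Squared distances are nonnegative reals, so the infimum is taken in [R] through real parts,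
    [R[i]] being only partially ordered. *)
Lemma near_minimizer_exists (e : R[i]) v : 0 < e -> exists f, near_minimizer e v f.
Proof.
move=> e0.
pose N f := dotn (fun i => v i - f i) (fun i => v i - f i).
have NE f : N f = (complex.Re (N f))%:C%C 
  by rewrite RRe_real// ger0_real// dotn_ge0.
have eE : e = (complex.Re e)%:C%C by rewrite RRe_real// gtr0_real.
have Ne : has_inf [set complex.Re (N f) | f in V].
  split; first by exists (complex.Re (N (fun=> 0))), (fun=> 0).
  by exists 0 => _ [f _ <-]; rewrite -lecR -NE dotn_ge0.
have re0 : 0 < complex.Re e by rewrite -ltcR -eE.
have [_ [f Vf <-] fe] := inf_adherent re0 Ne.
exists f; split=> // g Vg; rewrite -/(N f) -/(N g) NE (NE g) eE -rmorphD/= lecR.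
apply: (le_trans (ltW fe)); rewrite lerD2r ge_inf//; first by case: Ne.
by exists g.
Qed.

Lemma near_minimizer_ge0 e v f : near_minimizer e v f -> 0 <= e.
Proof. by move=> [Vf /(_ _ Vf)]; rewrite lerDl. Qed.

(** The vectors [f + c g] stay in [V], so [v - f] and [g] satisfy the hypothesis of
    [near_minimizer_dot]. *)
Lemma near_minimizer_orth e v f g : near_minimizer e v f -> V g ->
  `|dotn (fun i => v i - f i) g| ^+ 2 <= e * dotn g g.
Proof.
move=> [Vf fe] Vg; apply: near_minimizer_dot => c.
have := fe _ (VP c Vg Vf); congr (_ <= dotn _ _ + _);
  by apply: funext => i; rewrite opprD addrCA addrC.
Qed.

(** With [z = f - f'] in [V], [dotn z z] is the difference of the products of [v - f'] and [v - f]
    with [z]. Both are small by near-orthogonality, (a + c)^2 <= 2 (a^2 + c^2) combines them, and a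
    factor [dotn z z] cancels. *)
Lemma near_minimizer_dist e e' v f f' :
  near_minimizer e v f -> near_minimizer e' v f' ->
  dotn (fun i => f i - f' i) (fun i => f i - f' i) <= 2 * (e + e').
Proof.
move=> fe fe'; set z := fun i => f i - f' i.
have Vz : V z.
  have := VP (-1) fe'.1 fe.1; congr V.
  by apply: funext => i; rewrite scaleN1r addrC.
have b := near_minimizer_orth fe Vz; have b' := near_minimizer_orth fe' Vz.
have zE : dotn z z = dotn (fun i => v i - f' i) z - dotn (fun i => v i - f i) z.
  rewrite -dotnBl; congr dotn; apply: funext => i.
  by rewrite /z opprB [RHS]addrC addrA subrK.
have [->|z0] := eqVneq (dotn z z) 0.
  by rewrite mulr_ge0 ?addr_ge0 ?(near_minimizer_ge0 fe) ?(near_minimizer_ge0 fe').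
have zp : 0 < dotn z z by rewrite lt_def z0 dotn_ge0.
rewrite -(ler_pM2r zp) -mulrA (mulrDl e) (addrC (e * _)).
apply: (le_trans _ (ler_wpM2l (ler0n _ 2) (lerD b' b))).
have := ler_normB (dotn (fun i => v i - f' i) z) (dotn (fun i => v i - f i) z).
rewrite -zE ger0_norm ?dotn_ge0// => zab.
set a := `|_| in zab *; set c := `|_| in zab *.
have a0 : 0 <= a by exact: normr_ge0.
have c0 : 0 <= c by exact: normr_ge0.
apply: (@le_trans _ _ ((a + c) ^+ 2)).
  by rewrite -expr2 ler_pXn2r// nnegrE ?addr_ge0 ?dotn_ge0.
rewrite -subr_ge0.
have -> : 2 * (a ^+ 2 + c ^+ 2) - (a + c) ^+ 2 = (a - c) ^+ 2.
  by rewrite sqrrB sqrrD; ring.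
by rewrite -realEsqr realB ?ger0_real.
Qed.

(** Near minimizers with slack 1/(m+1) form a Cauchy sequence. The limit [w] is delivered with a
    sequence of [V] tending to it; when [V] is closed, this puts [w] in [V]. *)
Lemma projection_theorem (v : 'I_n -> K) :
  exists (u : nat -> 'I_n -> K) (w : 'I_n -> K),
    [/\ forall m, V (u m), forall i, u^~ i @ \oo --> w i &
        forall g, V g -> \sum_i inner (v i - w i) (g i) = 0 :> R[i]].
Proof.
pose e m : R[i] := (harmonic m)%:C%C.
have e0 m : 0 < e m by rewrite ltcR harmonic_gt0.
have e_lt (d : R[i]) : 0 < d -> \forall m \near \oo, e m <= d.
  move=> d0.
  have dE : d = (complex.Re d)%:C%C by rewrite RRe_real// gtr0_real.
  have rd0 : 0 < complex.Re d by rewrite -ltcR -dE.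
  have /cvgr0Pnorm_le/(_ _ rd0) := @cvg_harmonic R.
  apply: filterS => m; rewrite ger0_norm ?harmonic_ge0// => h.
  by rewrite dE lecR.
have /choice[u uP] m := near_minimizer_exists v (e0 m).
have cu i : cvg (u^~ i @ \oo).
  apply: cauchy_cvg; apply/cauchyP => d d0.
  (* Two slacks of at most d^2/8 give a squared distance of at most d^2/2. *)
  have d20 : 0 < d ^+ 2 / 8 by rewrite divr_gt0// exprn_gt0.
  have [N _ NP] := e_lt _ d20.
  exists (u N i), N => // m Nm.
  rewrite /= -ball_normE/=.
  have : `|u N i - u m i| ^+ 2 < d ^+ 2.
    apply: (le_lt_trans (norm_le_dotn (fun i => u N i - u m i) i)).
    apply: (le_lt_trans (near_minimizer_dist (uP N) (uP m))).
    have eN : e N <= d ^+ 2 / 8 by apply: NP => /=.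
    have em : e m <= d ^+ 2 / 8 by exact: NP.
    apply: (le_lt_trans (ler_wpM2l (ler0n _ 2) (lerD eN em))).
    have -> : 2 * (d ^+ 2 / 8 + d ^+ 2 / 8) = d ^+ 2 / 2 :> R[i] by field.
    by rewrite ltr_pdivrMr// ltr_pMr ?exprn_gt0// ltr1n.
  by rewrite ltr_pXn2r// nnegrE// ltW.
exists u, (fun i => lim (u^~ i @ \oo)); split => // [m|g Vg]; first exact: (uP m).1.
have c1 : (fun m => dotn (fun i => v i - u m i) g : (R[i] : numFieldType)) @ \oo -->
    (\sum_i inner (v i - lim (u^~ i @ \oo)) (g i) : R[i]^o).
  apply: (@cvg_sum R[i] R[i]^o _ _ _ _ (index_enum 'I_n)
    (fun i m => inner (v i - u m i) (g i))
    (fun i => inner (v i - lim (u^~ i @ \oo)) (g i))) => i.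
  have vi : (fun m => v i - u m i) @ \oo --> v i - lim (u^~ i @ \oo).
    by apply: cvgB; [exact: cvg_cst|exact: cu].
  exact: (cvg_inner vi).
have c2 : (fun m => dotn (fun i => v i - u m i) g : (R[i] : numFieldType)) @ \oo
    --> (0 : (R[i] : numFieldType)).
  apply/cvgrPdist_le => d d0.
  (* Near-orthogonality bounds the squared product by [e m * dotn g g]; the added 1 covers
     [dotn g g = 0]. *)
  have N0 := dotn_ge0 g; have N1 : 0 < dotn g g + 1 by rewrite ltr_wpDl.
  have := e_lt _ (divr_gt0 (exprn_gt0 2 d0) N1).
  apply: filterS => m em; rewrite sub0r normrN.
  have : `|dotn (fun i => v i - u m i) g| ^+ 2 <= d ^+ 2.
    apply: (le_trans (near_minimizer_orth (uP m) Vg)).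
    apply: (@le_trans _ _ (e m * (dotn g g + 1))).
      by rewrite ler_wpM2l ?(ltW (e0 m))// lerDl.
    by rewrite -ler_pdivlMr.
  by rewrite ler_pXn2r// nnegrE// ltW.
exact: (cvg_unique _ c1 c2).
Qed.

End Projection.

(** * Monotonicity of the dimension, and Riesz representation *)

Section Consequences.
Context {R : realType}.

(** The second alternative is the default of [xget], taken when [v] has no orthogonal projection in
    [V]. *)
Lemma orth_projP (K : hilbertType R) n (V : set ('I_n -> K)) v :
  (V (orth_proj V v) /\
     forall u, V u -> dotn (fun i => v i - orth_proj V v i) u = 0)
  \/ orth_proj V v = 0.
Proof. by rewrite /orth_proj; case: xgetP => [w _ []|]; [left|right]. Qed.

(** A genuine projection [w] of [v] satisfies <w, v> = <w, w>. As [w1] lies in [V2], <w2, w1> = <w1,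
    w1>, and Cauchy-Schwarz gives |w1|^2 <= |w2|^2. If [w1] is the default 0, the left side is 0. *)
Lemma vn_dim_le (K : hilbertType R) n (Omega : K) (V1 V2 : set ('I_n -> K)) :
  V1 `<=` V2 -> V2 (fun=> 0) ->
  (forall (c : R[i]) f g, V2 f -> V2 g -> V2 (fun i => c *: f i + g i)) ->
  (forall (u : nat -> 'I_n -> K) w, (forall m, V2 (u m)) ->
     (forall i, u^~ i @ \oo --> w i) -> V2 w) ->
  vn_dim Omega V1 <= vn_dim Omega V2.
Proof.
move=> V12 V20 V2P V2cl; rewrite /vn_dim.
(* A diagonal term of [vn_dim] is the quadratic form of the projection at the tuple with [Omega] in
   slot [i] and 0 elsewhere. *)
suff le12 : forall v, dotn (orth_proj V1 v) v <= dotn (orth_proj V2 v) v.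
  have entryE (T : ('I_n -> K) -> 'I_n -> K) i :
      inner (op_entry T i i Omega) Omega =
      dotn (T (fun k => if k == i then Omega else 0))
        (fun k => if k == i then Omega else 0) :> R[i].
    rewrite /dotn (bigD1 i)//= eqxx big1 ?addr0// => k /negPf ->.
    by rewrite innerC inner0l rmorph0.
  suff : \sum_i inner (op_entry (orth_proj V1) i i Omega) Omega <=
         \sum_i inner (op_entry (orth_proj V2) i i Omega) Omega :> R[i].
    by rewrite lecE => /andP[].
  by apply: ler_sum => i _; rewrite !entryE.
move=> v; set w1 := orth_proj V1 v; set w2 := orth_proj V2 v.
have [V2w2 w2P] : V2 w2 /\ forall u, V2 u -> dotn (fun i => v i - w2 i) u = 0.
  have [u [w [Vu uw wP]]] := projection_theorem V20 V2P v.
  apply: (@xgetPex _ 0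
    [set w | V2 w /\ forall u, V2 u -> dotn (fun i => v i - w i) u = 0]).
  by exists w; split => //; exact: V2cl Vu uw.
have dw (w : 'I_n -> K) : dotn (fun i => v i - w i) w = 0 -> dotn w v = dotn w w.
  by rewrite dotnBl => /subr0_eq h; rewrite dotnC h -dotnC.
have w2E := dw _ (w2P _ V2w2).
have [[V1w1 w1P]|w1E] := orth_projP V1 v; last first.
  have -> : dotn w1 v = 0.
    by rewrite /w1 w1E /dotn big1// => i _; rewrite inner0l.
  by rewrite w2E dotn_ge0.
have w1E := dw _ (w1P _ V1w1).
rewrite -/w1 in w1P w1E *; rewrite w1E w2E.
have [->|w10] := eqVneq (dotn w1 w1) 0; first exact: dotn_ge0.
have w1p : 0 < dotn w1 w1 by rewrite lt_def w10 dotn_ge0.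
have w21 : dotn w2 w1 = dotn w1 w1.
  have := w2P _ (V12 _ V1w1); rewrite dotnBl => /subr0_eq <-.
  by rewrite dotnC w1E -dotnC.
have := dotn_CauchySchwarz w2 w1; rewrite w21 ger0_norm ?dotn_ge0// expr2.
by rewrite ler_pM2r.
Qed.

(* The functional is only given on a subspace: z spans the orthogonal complement
   of the closure of its kernel in the closure of that subspace. *)
Lemma riesz (E : lmodType R[i]) (L : hilbertType R) (D : set E) (Lam : E -> L)
    (f : E -> R[i]) (C : R[i]) :
  0 <= C -> (forall c a b, D a -> D b -> D (c *: a + b)) ->
  (forall c a b, D a -> D b -> Lam (c *: a + b) = c *: Lam a + Lam b) ->
  (forall c a b, D a -> D b -> f (c *: a + b) = c * f a + f b) ->
  (forall a, D a -> `|f a| <= C * `|Lam a|) ->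
  exists z : L, forall a, D a -> f a = inner (Lam a) z.
Proof.
move=> C0 DP LamP fP fC.
have [[a0 Da0 fa0]|f0] := pselect (exists2 a0, D a0 & f a0 != 0); last first.
  exists 0 => a Da; rewrite innerC inner0l rmorph0.
  by apply: contrapT => /eqP fa; apply: f0; exists a.
(* Tuples of length one bring [L] itself under the projection theorem for sums. *)
pose V : set ('I_1 -> L) := [set g | exists a, [/\ D a, f a = 0 & g = fun=> Lam a]].
have V0 : V (fun=> 0).
  exists (-1 *: a0 + a0); split; first exact: DP.
    by rewrite fP// mulN1r addNr.
  by apply: funext => _; rewrite LamP// scaleN1r addNr.
have VP (c : R[i]) g h : V g -> V h -> V (fun i => c *: g i + h i).
  move=> [a [Da fa ->]] [b [Db fb ->]]; exists (c *: a + b).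
  by split; [exact: DP|rewrite fP// fa fb mulr0 addr0|rewrite LamP].
have [u [w [Vu uw wP]]] := projection_theorem V0 VP (fun=> Lam a0).
pose s := Lam a0 - w ord0.
have sP a : D a -> f a = 0 -> inner (Lam a) s = 0 :> R[i].
  move=> Da fa; have Va : V (fun=> Lam a) by exists a.
  by have := wP _ Va; rewrite big_ord1 => h; rewrite innerC h rmorph0.
pose k : R[i] := inner (Lam a0) s.
(* If [k = 0], then [s] is orthogonal to every [Lam a0 - u m], hence to their limit [s]. So [s = 0],
   and [Lam a0] is a limit of kernel vectors, against the bound on [f]. *)
have /eqP k0 : k != 0.
  apply/eqP => k0.
  have u0 m : inner (Lam a0 - u m ord0) s = 0 :> R[i].
    by have [b [Db fb ->]] := Vu m; rewrite innerBl -/k k0 sP// subr0.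
  have s0 : s = 0.
    have cs : (fun m => Lam a0 - u m ord0) @ \oo --> s.
      by apply: cvgB; [exact: cvg_cst|exact: uw].
    have c0 : (fun m => inner (Lam a0 - u m ord0) s) @ \oo -->
        (0 : (R[i] : numFieldType)).
      rewrite (_ : (fun m => _) = fun=> 0); first exact: cvg_cst.
      by apply: funext => m; rewrite u0.
    have : inner s s = 0 :> R[i] by exact: (cvg_unique _ (cvg_inner cs) c0).
    by rewrite inner_norm => /eqP; rewrite sqrf_eq0 normr_eq0 => /eqP.
  have Cp : 0 < C + 1 by rewrite ltr_wpDl.
  (* A kernel vector this close to [Lam a0] would force |f a0| <= |f a0| / 2. *)
  have fp : 0 < `|f a0| / (2 * (C + 1)) by rewrite divr_gt0 ?normr_gt0// mulr_gt0.
  have /cvgrPdist_le/(_ _ fp)[N _ /(_ N (leqnn _))/=] := uw ord0.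
  have -> : w ord0 = Lam a0 by apply/esym/subr0_eq.
  have [b [Db fb ->]] := Vu N.
  have -> : Lam a0 - Lam b = Lam (-1 *: b + a0) by rewrite LamP// scaleN1r addrC.
  move=> h.
  have := fC _ (DP (-1) _ _ Db Da0); rewrite fP// fb mulr0 add0r => fle.
  have : `|f a0| <= `|f a0| / 2.
    apply: (le_trans fle); apply: (le_trans (ler_wpM2l C0 h)).
    rewrite invfM mulrCA ler_pM2l ?normr_gt0// mulrA (mulrC C) -mulrA.
    by rewrite ler_piMr ?invr_ge0// ler_pdivrMr// mul1r lerDl.
  by rewrite ler_pdivlMr// ger_pMr ?normr_gt0// lern1.
(* Since [x - (f x / f a0) a0] is in the kernel of [f], <Lam x, s> = (f x / f a0) k. The conjugate
   offsets the antilinearity of [inner] on the right. *)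
exists ((f a0 / k)^* *: s) => x Dx.
rewrite innerZr conjCK.
have := sP (- (f x / f a0) *: a0 + x) (DP _ _ _ Da0 Dx).
rewrite fP// mulNr divfK// addNr => /(_ erefl).
rewrite LamP// innerDl innerZl -/k mulNr => /eqP; rewrite addrC subr_eq0 => /eqP ->.
by rewrite mulrC; field; apply/andP; split => //; apply/eqP.
Qed.

End Consequences.

(** * Adjoints, bounded operators and generated star-algebras *)

Section Operators.
Context {R : realType} {H : hilbertType R}.
Implicit Types (S T : H -> H).

Lemma is_adjoint_sym S T : is_adjoint S T -> is_adjoint T S.
Proof. by move=> ST u v; rewrite innerC -ST -innerC. Qed.

Lemma is_adjoint_comp S S' T T' :
  is_adjoint S S' -> is_adjoint T T' -> is_adjoint (S \o T) (T' \o S').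
Proof. by move=> SS TT u v; rewrite /= SS TT. Qed.

Lemma is_adjoint_uniq S T T' : is_adjoint S T -> is_adjoint S T' -> T = T'.
Proof.
move=> ST ST'; apply: funext => v; apply/eqP; rewrite -subr_eq0; apply/eqP.
apply: inner_eq0 => u; rewrite innerBl innerC -ST ST' -innerC.
by rewrite subrr.
Qed.

Lemma bounded_opP T : bounded_op T ->
  exists2 C : R[i], 0 <= C & forall u, `|T u| <= C * `|u|.
Proof.
move=> [lT cT].
pose f : {linear H -> H} := HB.pack T (GRing.isLinear.Build _ _ _ _ T lT).
have /linear_boundedP/pinfty_ex_gt0[C C0 fC] : bounded_near f (nbhs 0).
  exact/linear_bounded_continuous.
by exists C; [exact: ltW|exact: fC].
Qed.

Lemma bounded_opD T u v : bounded_op T -> T (u + v) = T u + T v.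
Proof. by move=> [lT _]; have := lT 1 u v; rewrite !scale1r. Qed.

Lemma bounded_op0 T : bounded_op T -> T 0 = 0.
Proof.
move=> [lT _]; have := lT (-1) 0 0.
by rewrite scaler0 addr0 scaleN1r addNr.
Qed.

Lemma bounded_op_sum T I (r : seq I) (F : I -> H) : bounded_op T ->
  T (\sum_(i <- r) F i) = \sum_(i <- r) T (F i).
Proof.
move=> bT; apply: (big_morph T) => [u v|]; first exact: bounded_opD.
exact: bounded_op0.
Qed.

Lemma bounded_op_cvg T {I : Type} {F : set_system I} {FF : Filter F}
    (u : I -> H) w :
  bounded_op T -> u @ F --> w -> (fun t => T (u t)) @ F --> T w.
Proof. by move=> [_ cT] uw; apply: continuous_cvg => //; exact: cT. Qed.

Lemma bounded_op_cst0 : bounded_op (0 : H -> H).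
Proof.
split; first by move=> c u v; rewrite scaler0 addr0.
by move=> u; exact: cvg_cst.
Qed.

Lemma bounded_op_add S T : bounded_op S -> bounded_op T -> bounded_op (S + T).
Proof.
move=> [lS cS] [lT cT]; split=> [c u v|u]; last exact: cvgD (cS u) (cT u).
rewrite /= !fctE lS lT scalerDr addrACA//.
Qed.

Lemma continuous_innerl (w : H) :
  continuous (fun u => inner u w : (R[i] : numFieldType)).
Proof. by move=> u; apply: cvg_inner; exact: cvg_id. Qed.

Lemma star_subalgebraD (A : set (H -> H)) S T :
  star_subalgebra A -> A S -> A T -> A (S + T).
Proof. by move=> [_ _ AP _ _] AS AT; have := AP 1 _ _ AS AT; rewrite scale1r. Qed.

(** Boundedness is inherited from [M]. The adjoint of [T] in [M] lies in every algebra of the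
    intersection, because each contains an adjoint of [T] and adjoints are unique. *)
Lemma star_subalgebra_gen (M B : set (H -> H)) n (X : 'I_n -> H -> H) :
  star_subalgebra M -> B `<=` M -> (forall i, M (X i)) ->
  star_subalgebra (gen_alg B X).
Proof.
move=> sM BM XM.
have sub T : gen_alg B X T -> M T by exact.
split.
- by case: sM => Mb _ _ _ _ T /sub/Mb.
- by move=> A [].
- move=> c S T AS AT A sA BA XA; have [_ _ + _ _] := sA.
  by apply; [exact: AS|exact: AT].
- move=> S T AS AT A sA BA XA; have [_ _ _ + _] := sA.
  by apply; [exact: AS|exact: AT].
- move=> T AT; case: (sM) => _ _ _ _ /(_ _ (sub _ AT))[T' _ TT'].
  exists T' => // A sA BA XA.
  case: (sA) => _ _ _ _ /(_ _ (AT A sA BA XA))[T2 AT2 TT2].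
  by rewrite (is_adjoint_uniq TT' TT2).
Qed.

Lemma continuous_closure0 (W : normedModType R[i]) (D : set H) (g : H -> W) :
  continuous g -> (forall u, D u -> g u = 0) -> forall u, closure D u -> g u = 0.
Proof.
move=> cg gD u Du.
have cl : closed (g @^-1` [set 0]).
  apply: closed_comp => [? _|]; first exact: cg.
  exact/accessible_closed_set1/hausdorff_accessible/norm_hausdorff.
have : closure (g @^-1` [set 0]) u by apply: (closureS _ Du) => v /gD.
by move/closure_id: cl => <-.
Qed.

End Operators.

(** * Coefficients of difference quotients *)

Lemma nc_diff_over (C : Type) (n : nat) (B : set C) (one : C) (i : 'I_n)
    (p : ncpoly C n) : B one -> nc_over B p ->
  all (fun t => `[< nc_over B t.1 /\ nc_over B t.2 >]) (nc_diff one i p).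
Proof.
move=> B1.
elim: p => //= [j _|p IHp q IHq [/IHp Bp /IHq Bq]|p IHp q IHq [Bp Bq]].
- by case: eqP => //= _; rewrite andbT; exact/asboolP.
- by rewrite all_cat Bp.
rewrite all_cat !all_map; apply/andP; split.
  by apply: sub_all (IHq Bq) => t /asboolP[? ?]; exact/asboolP.
by apply: sub_all (IHp Bp) => t /asboolP[? ?]; exact/asboolP.
Qed.

Lemma eq_bigr_all (T : Type) (V : nmodType) (s : seq T) (P : pred T)
    (F G : T -> V) :
  all P s -> (forall t, P t -> F t = G t) -> \sum_(t <- s) F t = \sum_(t <- s) G t.
Proof.
move=> + FG; elim: s => [|t s IHs] /=; first by rewrite !big_nil.
by case/andP=> /FG Pt /IHs ss; rewrite !big_cons Pt ss.
Qed.

(** * The bimodule action on the L^2 space of the tensor product *)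

Section Tensor.
Context {R : realType} {H L K : hilbertType R}.
Variables (M : set (H -> H)) (tau : (H -> H) -> R[i]) (Lam : (H -> H) -> L).
Variables (Th : (H -> H) -> (H -> H) -> K) (act : (H -> H) -> (H -> H) -> K -> K).
Hypotheses (starM : star_subalgebra M).
Hypotheses (trM : faithful_normal_tracial_state M tau).
Hypotheses (L2M : is_L2 M tau Lam) (L2MM : is_L2_tensor_op M tau Th act).

Let M1 : M idfun. Proof. by case: starM. Qed.
Let Mcomp S T : M S -> M T -> M (S \o T).
Proof. by case: starM => _ _ _ + _; exact. Qed.
Let Madj T : M T -> exists2 T', M T' & is_adjoint T T'.
Proof. by case: starM => _ _ _ _; exact. Qed.
Let tau1 : tau idfun = 1. Proof. by case: trM => -[]. Qed.
Let tauC S T : M S -> M T -> tau (S \o T) = tau (T \o S).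
Proof. by case: trM => _ _ _ + _; exact. Qed.
Let LamE a b b' : M a -> M b -> M b' -> is_adjoint b b' ->
  inner (Lam a) (Lam b) = tau (b' \o a) :> R[i].
Proof. by case: L2M => _ + _; exact. Qed.
Let ThE a b c c' d d' : M a -> M b -> M c -> M c' -> M d -> M d' ->
  is_adjoint c c' -> is_adjoint d d' ->
  inner (Th a b) (Th c d) = tau (c' \o a) * tau (b \o d') :> R[i].
Proof. by case: L2MM => _ + _ _ _; exact. Qed.
Let actb x y : M x -> M y -> bounded_op (act x y).
Proof. by case: L2MM => _ _ _ + _; exact. Qed.
Let actE x y a b : M x -> M y -> M a -> M b ->
  act x y (Th a b) = Th (x \o a) (b \o y).
Proof. by case: L2MM => _ _ _ _; exact. Qed.

(** Scalars in [tens_span] are absorbed in the tensor factors, so additivity of [g] suffices. *)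
Lemma tens_span_eq0 (A : set (H -> H)) (W : zmodType) (g : K -> W) :
  g 0 = 0 -> {morph g : u v / u + v} ->
  (forall a b, A a -> A b -> g (Th a b) = 0) ->
  forall u, tens_span A Th u -> g u = 0.
Proof.
move=> g0 gD gTh u [m [a [b [ab ->]]]].
rewrite (big_morph g gD g0) big1// => i _.
by have [Aa Ab] := ab i; exact: gTh.
Qed.

(** By density, identities on [K] reduce to computations with [actE] and [ThE] on elementary
    tensors. *)
Lemma tensor_eq0 (W : normedModType R[i]) (g : K -> W) :
  continuous g -> g 0 = 0 -> {morph g : u v / u + v} ->
  (forall a b, M a -> M b -> g (Th a b) = 0) -> forall u, g u = 0.
Proof.
move=> cg g0 gD gTh u.
apply: (continuous_closure0 cg (tens_span_eq0 g0 gD gTh)).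
case: L2MM => _ _ dM _ _ O uO.
have [v [Ov Mv]] : O^° `&` tens_span M Th !=set0.
  by apply: dM; [exists u; exact: uO|exact: open_interior].
by exists v; split => //; exact: interior_subset.
Qed.

Lemma act_id u : act idfun idfun u = u.
Proof.
apply/eqP; rewrite -subr_eq0; apply/eqP.
have b1 := actb M1 M1.
apply: (@tensor_eq0 _ (fun u => act idfun idfun u - u)).
- by move=> v; apply: cvgB; [exact: (b1.2)|exact: cvg_id].
- by rewrite (bounded_op0 b1) subrr.
- by move=> v w; rewrite (bounded_opD _ _ b1) opprD addrACA.
- by move=> a b Ma Mb; rewrite actE// subrr.
Qed.

Lemma act_comp x y x' y' u : M x -> M y -> M x' -> M y' ->
  act x y (act x' y' u) = act (x \o x') (y' \o y) u.
Proof.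
move=> Mx My Mx' My'; apply/eqP; rewrite -subr_eq0; apply/eqP.
have b1 := actb Mx My; have b2 := actb Mx' My'.
have b3 := actb (Mcomp Mx Mx') (Mcomp My' My).
apply: (@tensor_eq0 _ (fun u => act x y (act x' y' u) - act (x \o x') (y' \o y) u)).
- move=> v; apply: cvgB; last exact: b3.2.
  by apply: bounded_op_cvg => //; exact: b2.2.
- by rewrite (bounded_op0 b2) (bounded_op0 b1) (bounded_op0 b3) subrr.
- move=> v w; rewrite (bounded_opD _ _ b2) (bounded_opD _ _ b1).
  by rewrite (bounded_opD _ _ b3) opprD addrACA.
- by move=> a b Ma Mb; rewrite !actE ?subrr//; exact: Mcomp.
Qed.

Lemma act_adjoint x x' y y' u v : M x -> M x' -> M y -> M y' ->
  is_adjoint x x' -> is_adjoint y y' ->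
  inner (act x y u) v = inner u (act x' y' v) :> R[i].
Proof.
move=> Mx Mx' My My' xx' yy'.
have b := actb Mx My; have b' := actb Mx' My'.
apply/eqP; rewrite -subr_eq0; apply/eqP.
apply: (@tensor_eq0 R[i]^o
  (fun u => inner (act x y u) v - inner u (act x' y' v))) => [w| |w w'|].
- apply: (@cvgB R[i] R[i]^o); last exact: continuous_innerl.
  by apply: cvg_inner; exact: b.2.
- by rewrite (bounded_op0 b) !inner0l subrr.
- by rewrite (bounded_opD _ _ b) !innerDl opprD addrACA.
(* Conjugating both sides puts [v] in the left slot, so that the density argument applies to it as
   well. *)
move=> a c Ma Mc; apply/eqP; rewrite subr_eq0 innerC [eqbRHS]innerC; apply/eqP.
congr (_^*).
apply/esym/eqP; rewrite -subr_eq0; apply/eqP.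
apply: (@tensor_eq0 R[i]^o
  (fun v => inner (act x' y' v) (Th a c) - inner v (act x y (Th a c))))
  => [w| |w w'|].
- apply: (@cvgB R[i] R[i]^o); last exact: continuous_innerl.
  by apply: cvg_inner; exact: b'.2.
- by rewrite (bounded_op0 b') !inner0l subrr.
- by rewrite (bounded_opD _ _ b') !innerDl opprD addrACA.
move=> e f Me Mf; apply/eqP; rewrite subr_eq0; apply/eqP; rewrite !actE//.
have [a' Ma' aa'] := Madj Ma; have [c' Mc' cc'] := Madj Mc.
rewrite (@ThE _ _ _ a' _ c')//; try exact: Mcomp.
rewrite (@ThE _ _ _ (a' \o x') _ (y' \o c'))//; try exact: Mcomp;
  exact: is_adjoint_comp.
Qed.

(** As [tau idfun = 1], x (x) 1 has the 2-norm of [x]; this carries bounds for [act] on [K] over to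
    [Lam]. *)
Lemma norm_Thl x : M x -> `|Th x idfun| = `|Lam x|.
Proof.
move=> Mx; have [x' Mx' xx'] := Madj Mx.
apply/eqP; rewrite -(@eqrXn2 _ 2)// -!inner_norm (@ThE _ _ _ x' _ idfun)//.
by rewrite (LamE _ _ Mx')// [X in _ * X]tau1 mulr1.
Qed.

(** The square is now [tau (x \o x')], and the trace property exchanges the factors. *)
Lemma norm_Thr x : M x -> `|Th idfun x| = `|Lam x|.
Proof.
move=> Mx; have [x' Mx' xx'] := Madj Mx.
apply/eqP; rewrite -(@eqrXn2 _ 2)// -!inner_norm (@ThE _ _ _ idfun _ x')//.
by rewrite (LamE _ _ Mx')// [X in X * _]tau1 mul1r tauC.
Qed.

Lemma norm_Lam_adjoint x x' : M x -> M x' -> is_adjoint x x' ->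
  `|Lam x'| = `|Lam x|.
Proof.
move=> Mx Mx' xx'; have x'x := is_adjoint_sym xx'.
apply/eqP; rewrite -(@eqrXn2 _ 2)// -!inner_norm (LamE _ _ Mx)// (LamE _ _ Mx')//.
by rewrite tauC.
Qed.

(** The bounded operator [act a idfun] is tested on the vectors x (x) 1. *)
Lemma Lam_mull a : M a -> exists2 C : R[i], 0 <= C &
  forall x, M x -> `|Lam (a \o x)| <= C * `|Lam x|.
Proof.
move=> Ma; have [C C0 hC] := bounded_opP (actb Ma M1).
exists C => // x Mx; have := hC (Th x idfun).
by rewrite actE// norm_Thl// norm_Thl//; exact: Mcomp.
Qed.

Lemma Lam_mulr a : M a -> exists2 C : R[i], 0 <= C &
  forall x, M x -> `|Lam (x \o a)| <= C * `|Lam x|.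
Proof.
move=> Ma; have [C C0 hC] := bounded_opP (actb M1 Ma).
exists C => // x Mx; have := hC (Th idfun x).
by rewrite actE// norm_Thr// norm_Thr//; exact: Mcomp.
Qed.

(** Moved across the inner product, the operator yields [Th y' idfun], of norm the 2-norm of [y'],
    which is that of [y]. The bound is thus in the 2-norm of the multiplier, as the Leibniz
    remainders require. *)
Lemma act_left_le y (eta : K) : M y ->
  `|inner (act y idfun eta) (Th idfun idfun) : R[i]| <= `|eta| * `|Lam y|.
Proof.
move=> My; have [y' My' yy'] := Madj My.
rewrite (@act_adjoint _ y' _ idfun)// actE//.
rewrite -(norm_Lam_adjoint My My' yy') -norm_Thl//; exact: inner_CauchySchwarz.
Qed.

Lemma act_right_le y (eta : K) : M y ->
  `|inner (act idfun y eta) (Th idfun idfun) : R[i]| <= `|eta| * `|Lam y|.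
Proof.
move=> My; have [y' My' yy'] := Madj My.
rewrite (@act_adjoint _ idfun _ y')// actE//.
rewrite -(norm_Lam_adjoint My My' yy') -norm_Thr//; exact: inner_CauchySchwarz.
Qed.

(** * Derivations: domain of the adjoint and chain rule *)

Section Derivations.
Variables (B A : set (H -> H)).
Hypotheses (starA : star_subalgebra A) (AM : A `<=` M).
Variable delta : (H -> H) -> K.
Hypothesis derA : derivation Th act B A delta.

(* This is where [1 (x) 1] in the domain of the adjoint is used: by the Leibniz
   rule, [<delta x, a (x) b> = <delta (a^* x b^* ), 1 (x) 1>] up to two terms
   which are bounded for the 2-norm of [x]. *)
Lemma adjoint_domain_tensor a b :
  in_dom_adjoint Lam A delta (Th idfun idfun) -> A a -> A b ->
  exists z : L, forall x, A x -> inner (delta x) (Th a b) = inner (Lam x) z :> R[i].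
Proof.
move=> [zeta _ zetaP] Aa Ab.
have [Acomp Aadj] : (forall S T, A S -> A T -> A (S \o T)) /\
    (forall T, A T -> exists2 T', A T' & is_adjoint T T') by case: starA.
have [a' Aa' aa'] := Aadj _ Aa; have [b' Ab' bb'] := Aadj _ Ab.
have [_ dP dM _] := derA.
have [C1 C10 hC1] := Lam_mull (AM Aa'); have [C2 C20 hC2] := Lam_mulr (AM Ab').
have := is_adjoint_sym aa' => a'a; have := is_adjoint_sym bb' => b'b.
have [Ma Mb Ma' Mb'] := And4 (AM Aa) (AM Ab) (AM Aa') (AM Ab').
(* One summand per Leibniz term: the value at a' x b', controlled by [zeta], then the terms with
   [delta b'] and [delta a']. *)
pose C := C1 * C2 * `|zeta| + `|delta b'| * C1 + `|delta a'| * C2.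
apply: (@riesz _ _ _ _ Lam (fun x => inner (delta x) (Th a b)) C).
- by rewrite !addr_ge0// !mulr_ge0.
- by case: starA => _ _ + _ _; exact.
- by case: L2M => + _ _ => + c x y Ax Ay; apply; exact: AM.
- by move=> c x y Ax Ay; rewrite dP// innerDl innerZl.
move=> x Ax; have Mx := AM Ax.
have -> : inner (delta x) (Th a b) =
    inner (delta (a' \o (x \o b'))) (Th idfun idfun)
    - inner (act (a' \o x) idfun (delta b')) (Th idfun idfun)
    - inner (act idfun (x \o b') (delta a')) (Th idfun idfun) :> R[i].
  rewrite dM//; last exact: Acomp.
  rewrite innerDl [_ + inner (act idfun _ _) _ - _]addrAC addrK.
  rewrite (dM x b')// bounded_opD; last exact: actb.
  rewrite innerDl !act_comp// [_ + inner (act _ (_ \o _) _) _]addrC addrK.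
  have -> : Th a b = act a b (Th idfun idfun) by rewrite actE.
  by rewrite (@act_adjoint (a' \o idfun) a (b' \o idfun) b).
rewrite /C !mulrDl.
apply: (le_trans (ler_normB _ _)); apply: lerD; last first.
  apply: (le_trans (act_right_le _ (Mcomp Mx Mb'))).
  by rewrite -mulrA ler_wpM2l// hC2.
apply: (le_trans (ler_normB _ _)); apply: lerD; last first.
  apply: (le_trans (act_left_le _ (Mcomp Ma' Mx))).
  by rewrite -mulrA ler_wpM2l// hC1.
rewrite zetaP; last exact: (Acomp _ _ Aa' (Acomp _ _ Ax Ab')).
apply: (le_trans (inner_CauchySchwarz _ _)).
rewrite -mulrA (mulrC `|zeta|) mulrA ler_wpM2r// -mulrA.
apply: (le_trans (hC1 _ (Mcomp Mx Mb'))).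
by rewrite ler_wpM2l// hC2.
Qed.

Variables (n : nat) (X : 'I_n -> H -> H).
Hypotheses (BA : B `<=` A) (B1 : B idfun) (XA : forall i, A (X i)).

Lemma nc_eval_in p : nc_over B p -> A (nc_eval X p).
Proof.
elim: p => //= p IHp q IHq [/IHp Ap /IHq Aq].
- exact: star_subalgebraD.
- by case: starA => _ _ _ + _; exact.
Qed.

(** Induction on the expression. For a product, the Leibniz rule matches the two lists joined in
    [nc_diff], and [act_comp] absorbs the outer factor into a leg. *)
Lemma derivation_chain_rule p : nc_over B p ->
  delta (nc_eval X p) = \sum_i \sum_(t <- nc_diff idfun i p)
    act (nc_eval X t.1) (nc_eval X t.2) (delta (X i)).
Proof.
have [_ dP dM dB] := derA.
have A1 : A idfun by exact: BA.
elim: p => /= [b Bb|j _|p IHp q IHq [Bp Bq]|p IHp q IHq [Bp Bq]].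
- by rewrite dB// big1// => i _; rewrite big_nil.
- rewrite (bigD1 j)//= eqxx big_seq1 /= act_id big1 ?addr0// => i /negPf ij.
  by rewrite eq_sym ij big_nil.
- have := dP 1 _ _ (nc_eval_in Bp) (nc_eval_in Bq); rewrite !scale1r => ->.
  rewrite IHp// IHq// -big_split/=; apply: eq_bigr => i _.
  by rewrite big_cat.
have [Ap Aq] := (nc_eval_in Bp, nc_eval_in Bq).
have b1 := actb (AM Ap) M1; have b2 := actb M1 (AM Aq).
rewrite dM// IHp// IHq// (bounded_op_sum _ _ b1) (bounded_op_sum _ _ b2).
rewrite -big_split/=; apply: eq_bigr => i _.
rewrite big_cat !big_map/= (bounded_op_sum _ _ b1) (bounded_op_sum _ _ b2).
congr (_ + _).
  apply: eq_bigr_all (nc_diff_over i B1 Bq) _ => t /asboolP[B1t B2t].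
  by rewrite act_comp//; apply: AM => //; exact: nc_eval_in.
apply: eq_bigr_all (nc_diff_over i B1 Bp) _ => t /asboolP[B1t B2t].
by rewrite act_comp//; apply: AM => //; exact: nc_eval_in.
Qed.

End Derivations.

Lemma nc_jacobian_bounded (A B : set (H -> H)) n d (X : 'I_n -> H -> H)
    (P : 'I_d -> ncpoly (H -> H) n) j k :
  star_subalgebra A -> A `<=` M -> B `<=` A -> B idfun -> (forall i, A (X i)) ->
  nc_over B (P j) -> bounded_op (nc_jacobian act X P j k).
Proof.
move=> starA AM BA B1 XA BP; rewrite mxE.
elim: (nc_diff _ _ _) (nc_diff_over k B1 BP) => [_|t s IHs /=].
  by rewrite big_nil; exact: bounded_op_cst0.
case/andP => /asboolP[Bt1 Bt2] /IHs bs; rewrite big_cons.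
apply: bounded_op_add => //.
by apply: actb; apply: AM; exact: (nc_eval_in starA BA XA).
Qed.

End Tensor.

(** * Limits along nets, and kernels of operator matrices *)

Lemma net_filter_proper (I : Type) (le : I -> I -> Prop) :
  directed le -> ProperFilter (net_filter le).
Proof.
move=> [[i0 _] le_refl le_trans le_dir]; split.
  by move=> [i /(_ i (le_refl i))].
split.
- by exists i0.
- move=> P Q [i iP] [j jQ]; have [k [ik jk]] := le_dir i j.
  exists k => l kl; split; first exact: (iP _ (le_trans _ _ _ ik kl)).
  exact: (jQ _ (le_trans _ _ _ jk kl)).
- by move=> P Q PQ [i iP]; exists i => j /iP /PQ.
Qed.

Section Kernel.
Context {R : realType} {K : hilbertType R} {d n : nat} (T : 'M[K -> K]_(d, n)).
Hypothesis bT : forall j k, bounded_op (T j k).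

(** This and the next two lemmas make the kernel a closed subspace, as [vn_dim_le] asks. *)
Lemma mx_ker0 : mx_ker T (fun=> 0).
Proof. by move=> j; rewrite big1// => i _; exact: bounded_op0. Qed.

Lemma mx_kerP (c : R[i]) f g :
  mx_ker T f -> mx_ker T g -> mx_ker T (fun i => c *: f i + g i).
Proof.
move=> fT gT j; transitivity (c *: (\sum_i T j i (f i)) + \sum_i T j i (g i)).
  rewrite scaler_sumr -big_split/=; apply: eq_bigr => i _.
  by have [lT _] := bT j i; rewrite lT.
by rewrite fT gT scaler0 addr0.
Qed.

Lemma mx_ker_closed (u : nat -> 'I_n -> K) w : (forall m, mx_ker T (u m)) ->
  (forall i, u^~ i @ \oo --> w i) -> mx_ker T w.
Proof.
move=> uT uw j.
have c1 : (fun m => \sum_i T j i (u m i)) @ \oo --> \sum_i T j i (w i).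
  by apply: cvg_sum => i; apply: bounded_op_cvg => //; exact: uw.
have c0 : (fun m => \sum_i T j i (u m i)) @ \oo --> (0 : K).
  rewrite (_ : (fun m => _) = fun=> 0); first exact: cvg_cst.
  by apply: funext => m; exact: uT.
exact: (cvg_unique _ c1 c0).
Qed.

End Kernel.

(** * The bound on the free Stein dimension *)

Section MainTheorem.
Context {R : realType} {H L K : hilbertType R}.
Variables (M : set (H -> H)) (tau : (H -> H) -> R[i]) (Lam : (H -> H) -> L).
Variables (Th : (H -> H) -> (H -> H) -> K) (act : (H -> H) -> (H -> H) -> K -> K).
Hypotheses (starM : star_subalgebra M).
Hypotheses (trM : faithful_normal_tracial_state M tau).
Hypotheses (L2M : is_L2 M tau Lam) (L2MM : is_L2_tensor_op M tau Th act).
Variables (B : set (H -> H)) (n : nat) (X : 'I_n -> (H -> H)) (d : nat).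
Hypotheses (algB : star_subalgebra B) (subB : B `<=` M) (subX : forall i, M (X i)).
Variables (I : Type) (le : I -> I -> Prop) (P : I -> 'I_d -> ncpoly (H -> H) n).
Variable Hmx : 'M[K -> K]_(d, n).
Hypothesis dirI : directed le.
Hypothesis overP : forall i j, nc_over B (P i j).
Hypothesis P0 : forall j, weak_cvg le (fun i => Lam (nc_eval X (P i j))) 0.
Hypothesis bH : forall j k, bounded_op (Hmx j k).
Hypothesis PH :
  forall j k, wot_cvg le (fun i => nc_jacobian act X (P i) j k) (Hmx j k).

Let A := gen_alg B X.
Let starA : star_subalgebra A.
Proof. exact: star_subalgebra_gen starM subB subX. Qed.
Let AM : A `<=` M. Proof. by move=> T; apply. Qed.
Let BA : B `<=` A. Proof. by move=> T BT A' _ BA' _; exact: BA'. Qed.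
Let XA i : A (X i). Proof. by move=> A' _ _; exact. Qed.
Let B1 : B idfun. Proof. by case: algB. Qed.

Lemma Der11_mx_ker delta :
  Der11 Lam Th act B A delta -> mx_ker Hmx (fun i => delta (X i)).
Proof.
move=> [derA adjA] j; set w := \sum_i _.
have FF := net_filter_proper dirI.
have dcl a : A a -> closure (tens_span A Th) (delta a).
  by have [+ _ _ _] := derA; exact.
have jacE i : delta (nc_eval X (P i j)) =
    \sum_k nc_jacobian act X (P i) j k (delta (X k)).
  rewrite (derivation_chain_rule starM L2MM starA AM derA BA B1 XA (overP i j)).
  by apply: eq_bigr => k _; rewrite mxE fct_sumE.
(* The vectors [delta (X k)] are fixed along the net, so weak operator convergence applies to each
   summand. *)
have cw v : (fun i => inner (delta (nc_eval X (P i j))) v) @ net_filter le -->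
    inner w v.
  rewrite (_ : (fun i => _) = fun i =>
      \sum_k inner (nc_jacobian act X (P i) j k (delta (X k))) v
      :> (R[i] : numFieldType)); last first.
    by apply: funext => i; rewrite jacE inner_suml.
  rewrite /w inner_suml.
  apply: (@cvg_sum R[i] R[i]^o _ _ _ _ (index_enum 'I_n)
    (fun k i => inner (nc_jacobian act X (P i) j k (delta (X k))) v)
    (fun k => inner (Hmx j k (delta (X k))) v)) => k.
  exact: PH.
(* Against a (x) b the same net is that of the products of [Lam (nc_eval X (P i j))] with a fixed
   [z], which tends to 0. *)
have wTh a b : A a -> A b -> inner w (Th a b) = 0 :> R[i].
  move=> Aa Ab.
  have [z zP] := adjoint_domain_tensor starM trM L2M L2MM starA AM derA adjA Aa Ab.
  have c0 : (fun i => inner (delta (nc_eval X (P i j))) (Th a b))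
      @ net_filter le --> (0 : (R[i] : numFieldType)).
    rewrite (_ : (fun i => _) = fun i => inner (Lam (nc_eval X (P i j))) z);
      last first.
      by apply: funext => i; apply: zP; apply: (nc_eval_in starA BA XA).
    by have := @P0 j z; rewrite inner0l.
  exact: (cvg_unique _ (cw _) c0).
have wA u : closure (tens_span A Th) u -> inner u w = 0 :> R[i].
  apply: (@continuous_closure0 _ _ R[i]^o _ (fun u => inner u w)).
    exact: continuous_innerl.
  apply: tens_span_eq0; first exact: inner0l.
    by move=> u1 u2; exact: innerDl.
  by move=> a b Aa Ab; rewrite innerC wTh// rmorph0.
(* The net is tested against [w] itself: its terms vanish and its limit is <w, w>. *)
apply/eqP; rewrite -normr_eq0 -sqrf_eq0 -inner_norm; apply/eqP.
have c0 : (fun i => inner (delta (nc_eval X (P i j))) w) @ net_filter le -->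
    (0 : (R[i] : numFieldType)).
  rewrite (_ : (fun i => _) = fun=> 0); first exact: cvg_cst.
  by apply: funext => i; apply: wA; apply: dcl; apply: (nc_eval_in starA BA XA).
exact: (cvg_unique _ (cw _) c0).
Qed.

(** Approximants within 1/(m+1) in the norm of the generators converge at each generator, and the
    kernel is closed. *)
Lemma phi_closure_sub_mx_ker :
  phi_closure_Der11 Lam Th act B A X `<=` mx_ker Hmx.
Proof.
move=> _ [delta [derA approx ->]].
have e0 m : 0 < (harmonic m)%:C%C :> R[i] by rewrite ltcR harmonic_gt0.
have /choice[del delP] m := approx _ (e0 m).
apply: (@mx_ker_closed _ _ _ _ _ bH (fun m i => del m (X i))) => [m|k].
  exact: Der11_mx_ker (delP m).1.
apply/cvgrPdist_lt => e ep.
have eE : e = (complex.Re e)%:C%C by rewrite RRe_real// gtr0_real.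
have rep : 0 < complex.Re e by rewrite -ltcR -eE.
have /cvgr0Pnorm_lt/(_ _ rep) := @cvg_harmonic R.
apply: filterS => m; rewrite ger0_norm ?harmonic_ge0// => h.
have {}h : (harmonic m)%:C%C < (complex.Re e)%:C%C :> R[i] by rewrite ltcR.
rewrite eE; apply: lt_trans h.
apply: le_lt_trans (delP m).2.
(* Squaring removes the root; one coordinate is dominated by the whole sum. *)
rewrite -(@ler_pXn2r _ 2)// ?nnegrE ?sqrtC_ge0 ?sqrtCK//.
- by rewrite (bigD1 k)//= lerDl sumr_ge0// => i _; exact: exprn_ge0.
- by rewrite sumr_ge0// => i _; exact: exprn_ge0.
Qed.

Lemma free_stein_dim_le :
  free_stein_dim Lam Th act B X <= vn_dim (Th idfun idfun) (mx_ker Hmx).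
Proof.
apply: vn_dim_le; first exact: phi_closure_sub_mx_ker.
- exact: mx_ker0.
- exact: mx_kerP.
- exact: mx_ker_closed.
Qed.

End MainTheorem.

Theorem theorem3p2 (R : realType) (H L K : hilbertType R)
    (M : set (H -> H)) (tau : (H -> H) -> R[i])
    (Lam : (H -> H) -> L)
    (Th : (H -> H) -> (H -> H) -> K) (act : (H -> H) -> (H -> H) -> K -> K)
    (B : set (H -> H)) (n : nat) (X : 'I_n -> (H -> H)) (d : nat)
    (vnaM : is_vna M) (trM : faithful_normal_tracial_state M tau)
    (L2M : is_L2 M tau Lam) (L2MM : is_L2_tensor_op M tau Th act)
    (algB : star_subalgebra B) (subB : B `<=` M)
    (injX : injective X) (subX : forall i, M (X i))
    (starX : forall i, exists j, is_adjoint (X i) (X j))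
    (genM : commutant (commutant (gen_alg B X)) = M) :
  (forall (I : Type) (le : I -> I -> Prop)
      (P : I -> 'I_d -> ncpoly (H -> H) n) (Hmx : 'M[K -> K]_(d, n)),
    directed le ->
    (forall i j, nc_over B (P i j)) ->
    (forall j, weak_cvg le (fun i => Lam (nc_eval X (P i j))) 0) ->
    (forall j k, vn_tensor_op M act (Hmx j k)) ->
    (forall j k, wot_cvg le (fun i => nc_jacobian act X (P i) j k) (Hmx j k)) ->
    free_stein_dim Lam Th act B X <= vn_dim (Th idfun idfun) (mx_ker Hmx)) /\
  (forall P : 'I_d -> ncpoly (H -> H) n,
    (forall j, nc_over B (P j)) ->
    (forall j, nc_eval X (P j) = 0) ->
    free_stein_dim Lam Th act B X <=
      vn_dim (Th idfun idfun) (mx_ker (nc_jacobian act X P))).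
Proof.
have [starM _] := vnaM.
split=> [I le P Hmx dirI overP P0 vnH PH|P overP P0].
  apply: (free_stein_dim_le starM trM L2M L2MM algB subB subX dirI overP P0 _ PH).
  (* Elements of a commutant are bounded by definition. *)
  by move=> j k; case: (vnH j k).
have M0 : M 0.
  have [_ M1 MP _ _] := starM.
  by have := MP (-1) _ _ M1 M1; rewrite scaleN1r addNr.
have Lam0 : Lam 0 = 0.
  have [LamP _ _] := L2M.
  by have := LamP (-1) _ _ M0 M0; rewrite !scaleN1r !addNr.
(* A single tuple [P] is a constant net over a one-point directed set, with its own Jacobian as
   limit. *)
have dirU : directed (fun _ _ : unit => True).
  by split=> //; exists tt.
have FF := net_filter_proper dirU.
have B1 : B idfun by case: algB.
apply: (free_stein_dim_le starM trM L2M L2MM algB subB subX dirU (fun=> overP)).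
- by move=> j u; rewrite P0 Lam0; exact: cvg_cst.
- move=> j k.
  exact: (nc_jacobian_bounded L2MM k starM (@subset_refl _ M) subB B1 subX).
- by move=> j k u v; exact: cvg_cst.
Qed.
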